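(* Let $R$ be a commutative ring, $(A,q_A)$ a quaternion algebra over $R$ (a composition algebra of rank $4$), $n\ge1$, and $V=A\oplus H(R^n)$ with quadratic form $q(\alpha,v,w)=\alpha\overline{\alpha}+v\cdot w^{\intercal}$. Let $\phi:\mathrm{Cl}(V)\to M_{2^{n+1}}(A)$ be the $R$-algebra homomorphism extending the linear map $(\alpha,v,w)\mapsto\begin{pmatrix}0&Z_n(\alpha,v,w)\\\overline{Z_n(\alpha,v,w)}&0\end{pmatrix}$ (which squares to $q(\alpha,v,w)$). Then $\phi$ is injective, and $\mathrm{Cl}(V)$ and $M_{2^{n+1}}(A)$ have the same rank as free $R$-modules.
   Context: A composition algebra over $R$ is a unital $R$-algebra $A$, free of finite rank, containing $R$ via $1\mapsto1$, with a non-degenerate quadratic form $q_A$ satisfying $q_A(xy)=q_A(x)q_A(y)$; it has an involution $\alpha\mapsto\overline{\alpha}$ with $\alpha\overline{\alpha}=\overline{\alpha}\alpha=q_A(\alpha)$. A quadratic form is non-degenerate if its polar bilinear form $\langle x,y\rangle=q(x+y)-q(x)-q(y)$ satisfies: $\langle x,y\rangle=0$ for all $y$ implies $x=0$. $H(R^n)=R^n\oplus(R^n)^*$. For $v=(a_1,\dots,a_n)$, $w=(b_1,\dots,b_n)$: $Z_1(\alpha,v,w)=\begin{pmatrix}a_1&\alpha\\-\overline{\alpha}&b_1\end{pmatrix}$, $\overline{Z_1}=\begin{pmatrix}b_1&-\alpha\\\overline{\alpha}&a_1\end{pmatrix}$, and for $i>1$, $Z_i=\begin{pmatrix}a_i&Z_{i-1}\\-\overline{Z_{i-1}}&b_i\end{pmatrix}$,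 $\overline{Z_i}=\begin{pmatrix}b_i&-Z_{i-1}\\\overline{Z_{i-1}}&a_i\end{pmatrix}$ (scalars denote scalar multiples of the identity), so $Z_n\in M_{2^n}(A)$. $\mathrm{Cl}(V)$ is the Clifford algebra of $(V,q)$. *)

(* Defs.v *)
From HB Require Import structures.
From mathcomp Require Import all_boot all_order all_algebra.
Set Implicit Arguments. Unset Strict Implicit. Unset Printing Implicit Defensive.
Import GRing.Theory.
Local Open Scope ring_scope.

Definition polar (R : comRingType) (V : lmodType R) (q : V -> R) (x y : V) : R :=
  q (x + y) - q x - q y.

Definition is_quadratic_form (R : comRingType) (V : lmodType R) (q : V -> R) : Prop :=
  (forall (r : R) (x : V), q (r *: x) = r ^+ 2 * q x) /\
  (forall (r : R) (x y z : V), polar q (r *: x + y) z = r * polar q x z + polar q y z) /\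
  (forall x y : V, polar q x y = polar q y x).

Definition nondegenerate (R : comRingType) (V : lmodType R) (q : V -> R) : Prop :=
  forall x : V, (forall y : V, polar q x y = 0) -> x = 0.

Definition is_basis (R : comRingType) (T : zmodType) (scale : R -> T -> T)
    (k : nat) (b : 'I_k -> T) : Prop :=
  forall x : T, exists! c : 'rV[R]_k, x = \sum_(i < k) scale (c 0 i) (b i).

Definition is_Rlinear (R : comRingType) (U V : lmodType R) (f : U -> V) : Prop :=
  forall (r : R) (x y : U), f (r *: x + y) = r *: f x + f y.

Definition is_alg_hom (R : comRingType) (C B : algType R) (g : C -> B) : Prop :=
  is_Rlinear g /\ (forall x y : C, g (x * y) = g x * g y) /\ g 1 = 1.

Definition clifford_map (R : comRingType) (V : lmodType R) (q : V -> R)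
    (B : algType R) (f : V -> B) : Prop :=
  is_Rlinear f /\ forall x : V, f x * f x = (q x)%:A.

Definition is_clifford_algebra (R : comRingType) (V : lmodType R) (q : V -> R)
    (C : algType R) (iota : V -> C) : Prop :=
  clifford_map q iota /\
  forall (B : algType R) (f : V -> B), clifford_map q f ->
    exists! g : C -> B, is_alg_hom g /\ (forall x : V, g (iota x) = f x).

Definition is_quaternion_algebra (R : comRingType) (A : algType R)
    (qA : A -> R) (conj : A -> A) : Prop :=
  injective (fun r : R => r%:A : A) /\
  (exists b : 'I_4 -> A, is_basis (@GRing.scale R A) b) /\
  is_quadratic_form qA /\ nondegenerate qA /\
  (forall x y : A, qA (x * y) = qA x * qA y) /\
  is_Rlinear conj /\ (forall x : A, conj (conj x) = x) /\
  (forall x y : A, conj (x * y) = conj y * conj x) /\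
  (forall x : A, x * conj x = (qA x)%:A /\ conj x * x = (qA x)%:A).

Lemma pow2S (i : nat) : (2 ^ i + 2 ^ i = 2 ^ i.+1)%N.
Proof. by rewrite expnS mul2n addnn. Qed.

(* i-th coordinate (0-based) of a row vector, 0 out of range *)
Definition rv_at (R : comRingType) (n : nat) (v : 'rV[R]_n) (i : nat) : R :=
  if @insub _ (fun j => j < n)%N 'I_n i is Some j then v 0 j else 0.

(* Zpair i = (Z_i, \overline{Z_i}) with the convention Z_0 = alpha, \overline{Z_0} = conj alpha
   (1x1 matrices); for i >= 1 this gives exactly the recursive definition of the paper. *)
Fixpoint Zpair (R : comRingType) (A : algType R) (conj : A -> A) (al : A)
    (n : nat) (v w : 'rV[R]_n) (i : nat) : 'M[A]_(2 ^ i) * 'M[A]_(2 ^ i) :=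
  match i return 'M[A]_(2 ^ i) * 'M[A]_(2 ^ i) with
  | 0 => (al%:M, (conj al)%:M)
  | i'.+1 =>
    let Z := (Zpair conj al v w i').1 in
    let Zb := (Zpair conj al v w i').2 in
    let a := ((rv_at v i')%:A : A) in
    let b := ((rv_at w i')%:A : A) in
    (castmx (pow2S i', pow2S i') (block_mx a%:M Z (- Zb) b%:M),
     castmx (pow2S i', pow2S i') (block_mx b%:M (- Z) Zb a%:M))
  end.

Definition qV (R : comRingType) (A : algType R) (qA : A -> R) (n : nat)
    (x : A * ('rV[R]_n * 'rV[R]_n)) : R :=
  qA x.1 + (x.2.1 *m x.2.2^T) 0 0.

Definition gammaV (R : comRingType) (A : algType R) (conj : A -> A) (n : nat)
    (x : A * ('rV[R]_n * 'rV[R]_n)) : 'M[A]_(2 ^ n.+1) :=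
  castmx (pow2S n, pow2S n)
    (block_mx 0 (Zpair conj x.1 x.2.1 x.2.2 n).1 (Zpair conj x.1 x.2.1 x.2.2 n).2 0).

Definition mxscale (R : comRingType) (A : algType R) (m : nat) (r : R) (X : 'M[A]_m) : 'M[A]_m :=
  map_mx (fun a => r *: a) X.

(* Main.v *)
(** Products of the images in Cl(V) of a basis of V, in increasing order, span
   Cl(V); there are 2^(4+2n) of them, which is the rank of M_{2^(n+1)}(A). So it
   suffices that their images under phi are linearly independent: this gives
   injectivity of phi and shows that these products form a basis.

   As the polar form need not be unimodular, phi need not be onto, but for
   t = <xy - yx, z> its image contains t M_{2^(n+1)}(A): for n = 0 because
   diag(0, [x,y]z) and diag(0, z[x,y]) lie in the image, hence so does diag(0, t),
   and in the inductive step because the images of a hyperbolic pair cut out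
   corners. A relation c between the images then satisfies t^k c = 0, where k is
   the rank, by taking determinants.

   Finally the scalars t have no common annihilator. If r annihilates all of them,
   nondegeneracy gives r[x,y] = 0, so A is "commutative modulo Ann(r)"; the
   identities of composition algebras then express r d x, for suitable scalars d,
   through a map of rank at most 2, so r d^4 = 0 because A has rank 4 > 2. *)
Require Import Defs.
From HB Require Import structures.
From mathcomp Require Import all_boot all_order all_algebra.
From mathcomp Require Import ring zify.
From mathcomp Require boolp.
Import GRing.Theory.
Local Open Scope ring_scope.
Set Implicit Arguments. Unset Strict Implicit. Unset Printing Implicit Defensive.

(** * The scalars <xy - yx, z> of a quaternion algebra *)

(** Exponents may vary with the index, so that they can be lowered one at a time: if [r] is
    annihilated by all [t i ^+ N i], then [t i * r] is annihilated with [N i] lowered by one, hence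
    is zero by induction on the sum of the exponents. [P] restricts to annihilators with a property
    inherited by multiples, such as [central_mod]. *)
Lemma faithful_powers (R : comRingType) (P : R -> Prop) (I : finType) (t : I -> R) :
  (forall r s, P r -> P (s * r)) ->
  (forall r, P r -> (forall i, t i * r = 0) -> r = 0) ->
  forall (k : nat) r, P r -> (forall i, t i ^+ k * r = 0) -> r = 0.
Proof.
move=> PM faith k.
suff H m : forall (N : I -> nat) r, (\sum_i N i <= m)%N -> P r ->
    (forall i, t i ^+ N i * r = 0) -> r = 0.
  by move=> r Pr /(H _ (fun=> k)); apply.
elim: m => [|m IHm] N r leN Pr tN0.
  apply: faith => // i; have := tN0 i.
  have -> : N i = 0%N by move: leN; rewrite leqn0 sum_nat_eq0 => /forallP /(_ i)/eqP.
  by rewrite expr0 mul1r => ->; rewrite mulr0.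
apply: faith => // i; have := tN0 i; case Ni: (N i) => [|l].
  by rewrite expr0 mul1r => ->; rewrite mulr0.
move=> tl; apply: (IHm (fun j => if j == i then l else N j)); last 2 first.
- exact: PM.
- move=> j; case: eqP => [->|_]; first by rewrite mulrA -exprSr.
  by rewrite mulrCA tN0 mulr0.
rewrite -ltnS; apply: leq_trans leN.
rewrite (bigD1 i) //= [X in (_ < X)%N](bigD1 i) //= eqxx Ni addSn ltnS leq_add2l.
by apply: eq_leq; apply: eq_bigr => j /negbTE ->.
Qed.

(** The determinant is a polynomial in the entries, so it respects congruence modulo the annihilator
    of [r]. *)
Lemma mulr_det_congr (R : comRingType) (n : nat) (r : R) (M N : 'M[R]_n) :
  (forall i j, r * M i j = r * N i j) -> r * \det M = r * \det N.
Proof.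
move=> MN; rewrite !mulr_sumr; apply: eq_bigr => s _.
rewrite !(mulrCA r); congr (_ * _).
elim/big_rec2: _ => // i a b _ IH.
by rewrite mulrA MN -mulrA mulrCA IH mulrCA.
Qed.

Lemma basis_inj (R : comRingType) (T : zmodType) (scale : R -> T -> T) (k : nat) (b : 'I_k -> T) :
  is_basis scale b ->
  forall c d : 'I_k -> R, \sum_i scale (c i) (b i) = \sum_i scale (d i) (b i) -> c =1 d.
Proof.
move=> bB c d cd.
have [e [_ eU]] := bB (\sum_i scale (c i) (b i)).
move=> i; have /rowP/(_ i) : \row_i c i = \row_i d i.
  rewrite -(eU (\row_i c i)) ?(eU (\row_i d i)) //.
    by rewrite cd; apply: eq_bigr => j _; rewrite mxE.
  by apply: eq_bigr => j _; rewrite mxE.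
by rewrite !mxE.
Qed.

(** Modulo the annihilator of [r], multiplication by [d] factors through [R^2], so its determinant
    [d ^+ k] vanishes there because [k] exceeds 2. *)
Lemma scalar_rank2 (R : comRingType) (T : lmodType R) (k : nat) (b : 'I_k -> T)
    (r d : R) (f g : T -> R) (u v : T) :
  (2 < k)%N -> is_basis (@GRing.scale R T) b ->
  (forall x, (r * d) *: x = r *: (f x *: u + g x *: v)) -> r * d ^+ k = 0.
Proof.
move=> k2 bB H.
have [cu [Du _]] := bB u; have [cv [Dv _]] := bB v.
(* The two factors, of sizes [k] by 2 and 2 by [k], are padded with zeros to square matrices; the
   row of index 2 of [G] is then zero, whence [\det G = 0]. *)
pose F : 'M[R]_k := \matrix_(i, j)
  if j == 0%N :> nat then f (b i) else if j == 1%N :> nat then g (b i) else 0.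
pose G : 'M[R]_k := \matrix_(i, j)
  if i == 0%N :> nat then cu 0 j else if i == 1%N :> nat then cv 0 j else 0.
have i0 : 'I_k by exact: Ordinal k2.
have FG i j : (F *m G) i j = f (b i) * cu 0 j + g (b i) * cv 0 j.
  rewrite mxE (bigD1 (Ordinal (ltnW (ltnW k2)))) //= !mxE /=; congr (_ + _).
  rewrite (bigD1 (Ordinal (ltnW k2))) //= !mxE /= big1 ?addr0 // => l.
  rewrite -!val_eqE /= !mxE => /andP[/negbTE -> /negbTE ->].
  by rewrite mul0r.
transitivity (r * \det (d%:M : 'M[R]_k)); first by rewrite det_scalar.
transitivity (r * \det (F *m G)).
  apply: mulr_det_congr => i j; rewrite FG mxE.
  apply: (basis_inj bB (c := fun j => r * (d *+ (i == j)))
     (d := fun j => r * (f (b i) * cu 0 j + g (b i) * cv 0 j))).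
  rewrite (bigD1 i) //= eqxx mulr1n H big1 ?addr0; last first.
    by move=> l /negbTE; rewrite eq_sym => ->; rewrite mulr0n mulr0 scale0r.
  rewrite {1}Du {1}Dv !scaler_sumr -big_split scaler_sumr.
  by apply: eq_bigr => l _; rewrite /= !scalerA -scalerDl scalerA.
rewrite det_mulmx.
have -> : \det G = 0; last by rewrite !mulr0.
rewrite (expand_det_row _ (Ordinal k2)) big1 // => j _.
by rewrite !mxE mul0r.
Qed.

Section Quaternion.
Variables (R : comRingType) (A : algType R) (qA : A -> R) (conj : A -> A).
Hypothesis hA : is_quaternion_algebra qA conj.
Local Notation B := (polar qA).

Lemma scalar_inj : injective (fun r : R => r%:A : A). Proof. by case: hA. Qed.

Lemma conjD x y : conj (x + y) = conj x + conj y.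
Proof. by have [_ [_ [_ [_ [_ [/(_ 1 x y)]]]]]] := hA; rewrite !scale1r. Qed.

Lemma conj_mul x y : conj (x * y) = conj y * conj x.
Proof. by have [_ [_ [_ [_ [_ [_ [_ []]]]]]]] := hA. Qed.

Lemma conjK x : conj (conj x) = x.
Proof. by have [_ [_ [_ [_ [_ [_ []]]]]]] := hA. Qed.

Lemma mul_conj x : x * conj x = (qA x)%:A.
Proof. by have [_ [_ [_ [_ [_ [_ [_ [_ /(_ x)[]]]]]]]]] := hA. Qed.

Lemma conj0 : conj 0 = 0 :> A.
Proof. by apply: (addrI (conj 0)); rewrite -conjD !addr0. Qed.

Lemma conjN x : conj (- x) = - conj x.
Proof. by apply: (addrI (conj x)); rewrite -conjD !subrr conj0. Qed.

Lemma conjZ r x : conj (r *: x) = r *: conj x.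
Proof.
by have [_ [_ [_ [_ [_ [/(_ r x 0)]]]]]] := hA; rewrite conj0 !addr0.
Qed.

Lemma conj1 : conj 1 = 1 :> A.
Proof. by rewrite -[RHS]conjK -[conj 1 in RHS]mulr1 conj_mul conjK mulr1. Qed.

Lemma polar_conj x y : (B x y)%:A = x * conj y + y * conj x.
Proof.
rewrite /polar !scalerBl -!mul_conj conjD mulrDl !mulrDr.
by apply/eqP; rewrite !subr_eq [eqbRHS]addrC !addrA.
Qed.

Lemma polarC x y : B x y = B y x.
Proof. by rewrite /polar addrAC [x + y]addrC. Qed.

Lemma polarDl x y z : B (x + y) z = B x z + B y z.
Proof. by have [_ [_ [[_ [lin _]] _]]] := hA; move: (lin 1 x y z); rewrite scale1r mul1r. Qed.

Lemma polar0l z : B 0 z = 0.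
Proof. by apply: (addrI (B 0 z)); rewrite -polarDl !addr0. Qed.

Lemma polarZl r x z : B (r *: x) z = r * B x z.
Proof. by have [_ [_ [[_ [lin _]] _]]] := hA; move: (lin r x 0 z); rewrite polar0l !addr0. Qed.

Lemma polarBl x y z : B (x - y) z = B x z - B y z.
Proof. by rewrite polarDl -scaleN1r polarZl mulN1r. Qed.

Lemma polarDr x y z : B x (y + z) = B x y + B x z.
Proof. by rewrite !(polarC x) polarDl. Qed.

Lemma polarBr x y z : B x (y - z) = B x y - B x z.
Proof. by rewrite !(polarC x) polarBl. Qed.

Lemma polarZr r x y : B x (r *: y) = r * B x y.
Proof. by rewrite !(polarC x) polarZl. Qed.

Lemma polar_sumr x (I : finType) (c : I -> R) (b : I -> A) :
  B x (\sum_i c i *: b i) = \sum_i c i * B x (b i).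
Proof.
rewrite (big_morph _ (polarDr x) (id1 := 0)); last by rewrite polarC polar0l.
by apply: eq_bigr => i _; rewrite polarZr.
Qed.

Lemma polar_nondeg x : (forall y, B x y = 0) -> x = 0.
Proof. by have [_ [_ [_ [+ _]]]] := hA; apply. Qed.

Lemma trace_conj x : conj x = (B x 1)%:A - x.
Proof. by rewrite polar_conj conj1 mulr1 mul1r addrAC subrr add0r. Qed.

(** * Scalars annihilating all commutators *)

Definition central_mod (r : R) := forall x y : A, r *: (x * y) = r *: (y * x).

Lemma central_modM r s : central_mod r -> central_mod (s * r).
Proof. by move=> cr x y; rewrite -!scalerA cr. Qed.

Lemma scale_eq0 r : (forall x : A, r *: x = 0) -> r = 0.
Proof. by move=> r0; apply: scalar_inj; rewrite r0 scale0r. Qed.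

Lemma polar_nondegZ r x : (forall y, r * B x y = 0) -> r *: x = 0.
Proof. by move=> r0; apply: polar_nondeg => y; rewrite polarZl. Qed.

(** Substituting [conj y = B y 1 - y] and [conj x = B x 1 - x] in [polar_conj] expresses
    [x * y + y * x] linearly in [x], [y] and 1; modulo the annihilator of [r] this sum is twice
    [x * y]. *)
Lemma central_mod_anticomm r x y : central_mod r ->
  (r *+ 2) *: (x * y) = r *: (B 1 y *: x + B x 1 *: y - (B x y)%:A).
Proof.
move=> cr; rewrite polar_conj (trace_conj y) (trace_conj x) !mulrBr.
rewrite -!scalerAr !mulr1 (polarC 1 y).
rewrite opprD !opprB addrACA !subrKC mulr2n scalerDl {2}cr scalerDr //.
Qed.

Lemma trace_conj_add x : (B x 1)%:A - conj x = x.
Proof. by rewrite trace_conj opprB subrKC. Qed.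

(** With [r *+ 2 = 0] the left side of [central_mod_anticomm] disappears, and what remains expresses
    [r * B 1 x] times [y] through 1 and [x], a map of rank at most 2 in [y]. *)
Lemma central_mod_char2 r : central_mod r -> r *+ 2 = 0 -> r = 0.
Proof.
move=> cr r2; have [_ [[b bB] _]] := hA.
have tx4 x : B 1 x ^+ 4 * r = 0.
  rewrite mulrC.
  apply: (scalar_rank2 (f := B x) (g := fun y => - B 1 y) (u := 1) (v := x) _ bB) => // y.
  have := central_mod_anticomm x y cr; rewrite r2 scale0r => /esym/eqP.
  rewrite scalerBr subr_eq0 => /eqP E.
  by rewrite scalerDr -E scalerDr scaleNr scalerN addrAC subrr add0r scalerA (polarC 1).
(* The traces [B 1 (b i)] have no common annihilator: one would annihilate 1 by nondegeneracy. *)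
apply: (faithful_powers (P := fun=> True) (t := fun i => B 1 (b i)) _ _ (k := 4)) => // s _ s0.
apply: scale_eq0 => x; rewrite -[x]mul1r scalerAl polar_nondegZ ?mul0r // => y.
have [c [-> _]] := bB y.
by rewrite polar_sumr mulr_sumr big1 // => i _; rewrite mulrCA (mulrC s) s0 mulr0.
Qed.

Local Notation im x := (x - conj x).

Lemma conj_im x : conj (im x) = - im x.
Proof. by rewrite conjD conjN conjK opprB addrC. Qed.

(** [im x] is orthogonal to 1, so of [conj y = B y 1 - y] only the term [- y] contributes. *)
Lemma polar_im x y : B (im x) (im y) = 2 * B (im x) y.
Proof.
have: B (im x) 1 = 0.
  by apply: scalar_inj; rewrite polar_conj conj_im conj1 mulr1 mul1r subrr scale0r.
by rewrite [conj y]trace_conj => x0; rewrite polarBr polarBr polarZr x0 mulr0 sub0r opprK mulr_natl.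
Qed.

Lemma central_mod0 r : central_mod r -> r = 0.
Proof.
move=> cr; have [_ [[b bB] _]] := hA.
have imM s x y : central_mod s ->
    (s *+ 2) *: (im x * im y) = - (s * B (im x) (im y))%:A.
  move=> cs; rewrite -scalerA polar_conj !conj_im !mulrN -opprD scalerN opprK.
  by rewrite scalerDr [in RHS](cs (im y)) mulr2n scalerDl.
(* [imM] makes [im x * im y] and [im y * im z] scalars, so this is associativity of
   [im x * im y * im z]. *)
have imP s x y z : central_mod s ->
    s * B (im y) (im z) *: im x = s * B (im x) (im y) *: im z.
  move=> cs; apply: oppr_inj.
  rewrite -mulr_algr -[in RHS]mulr_algl -mulrN -mulNr -!imM //.
  by rewrite -scalerAr -scalerAl mulrA.
(* Twice [x] is its trace plus [im x], and [imP] trades the multiple of [im x] for one of the fixed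
   vector [im z]. *)
have rank2 y z x : (r * (2 * B (im y) (im z))) *: x =
    r *: ((B (im y) (im z) * B x 1) *: 1 + B (im x) (im y) *: im z).
  rewrite scalerDr !scalerA -imP //; set c := B (im y) (im z).
  have -> : r * (2 * c) = r * c * 2 by ring.
  rewrite -scalerA [r * (_ * _)]mulrA.
  rewrite -[X in _ = X + _]scalerA -scalerDr; congr (_ *: _).
  by rewrite addrCA trace_conj_add scaler_nat.
pose t (i : 'I_4 * 'I_4) := 2 * B (im (b i.1)) (im (b i.2)).
apply: (@faithful_powers _ central_mod _ t central_modM _ 4 r cr); last first.
  by move=> [i j]; rewrite mulrC; apply: (scalar_rank2 _ bB) => // x; apply: rank2.
move=> s cs s0.
(* By [polar_im] the scalars [t] are [4 * B (im (b i)) (b j)], so nondegeneracy applies to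
   [im (b i)]. *)
have{}s0 x : (4 * s) *: im x = 0.
  have [c [-> _]] := bB x.
  pose f x := (4 * s) *: im x.
  rewrite -/(f _) (big_morph f (id1 := 0) (op1 := +%R)); first last.
  - by rewrite /f conj0 subr0 scaler0.
  - by move=> u v; rewrite /f conjD opprD addrACA scalerDr.
  rewrite big1 // => i _; rewrite /f conjZ -scalerBr scalerA mulrC -scalerA.
  rewrite (@polar_nondegZ (4 * s)) ?scaler0 // => y.
  have [d [-> _]] := bB y.
  rewrite polar_sumr mulr_sumr big1 // => j _; rewrite mulrCA.
  have := s0 (i, j); rewrite /t /= polar_im => sij.
  have -> (u : R) : 4 * s * u = 2 * (2 * u) * s by ring.
  by rewrite sij mulr0.
(* As [im x] is twice [x] minus its trace, modulo the annihilator of [4 * s] doubling has rank at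
   most 1; hence [4 * 2 ^+ 4] annihilates [s]. *)
have : s *+ 64 = 0.
  rewrite -mulr_natl; transitivity (4 * s * 2 ^+ 4).
    by rewrite mulrAC -natrX -natrM.
  apply: (scalar_rank2 (f := fun x => B x 1) (g := fun=> 0) (u := 1) (v := 0) _ bB) => // x.
  rewrite scaler0 addr0; apply/eqP; rewrite -subr_eq0 -scalerA -scalerBr.
  by rewrite scalerDl scale1r -addrA -(opprB _ x) -trace_conj s0.
(* The six factors 2 of 64 are removed one by one with [central_mod_char2]. *)
have dbl k : forall u, central_mod u -> u *+ 2 ^ k = 0 -> u = 0.
  elim: k => [|k IH] u cu; first by rewrite mulr1n.
  rewrite expnSr mulrnA => /central_mod_char2-/(_ _)/IH; apply=> //.
  by rewrite -mulr_natl; apply: central_modM.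
exact: (dbl 6).
Qed.

(** By nondegeneracy and bilinearity a common annihilator kills every commutator, so [central_mod0]
    applies. *)
Lemma polar_commutator_faithful (b : 'I_4 -> A) (r : R) :
  is_basis (@GRing.scale R A) b ->
  (forall i j l, B (b i * b j - b j * b i) (b l) * r = 0) -> r = 0.
Proof.
move=> bB r0; apply: central_mod0 => x y.
have [c [-> _]] := bB x; have [d [-> _]] := bB y.
rewrite mulr_suml mulr_sumr !scaler_sumr; apply: eq_bigr => i _.
rewrite mulr_suml mulr_sumr !scaler_sumr; apply: eq_bigr => j _.
rewrite -!scalerAl -!scalerAr !scalerA [r * d 0 j * _]mulrAC -!(mulrA r) (mulrC r) -!scalerA.
congr (_ *: (_ *: _)); apply/eqP; rewrite -subr_eq0 -scalerBr; apply/eqP.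
apply: polar_nondegZ => z; have [e [-> _]] := bB z.
by rewrite polar_sumr mulr_sumr big1 // => l _; rewrite mulrCA (mulrC r) r0 mulr0.
Qed.

End Quaternion.

(** * Subalgebras of matrices containing the vectors Z_n *)

Definition mx_subalg (R : comRingType) (A : algType R) (m : nat) (S : 'M[A]_m -> Prop) :=
  [/\ forall X Y, S X -> S Y -> S (X + Y),
      forall r X, S X -> S (mxscale r X)
    & forall X Y, S X -> S Y -> S (X *m Y)].

Lemma mxscale_block (R : comRingType) (A : algType R) (m : nat) (r : R)
    (X Y Z T : 'M[A]_m) :
  mxscale r (block_mx X Y Z T) =
  block_mx (mxscale r X) (mxscale r Y) (mxscale r Z) (mxscale r T) :> 'M_(m + m).
Proof. exact: map_block_mx. Qed.

Lemma mxscale0 (R : comRingType) (A : algType R) (m : nat) (r : R) :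
  mxscale r (0 : 'M[A]_m) = 0.
Proof. by apply/matrixP=> i j; rewrite !mxE scaler0. Qed.

Lemma mxscale_scalar (R : comRingType) (A : algType R) (m : nat) (r : R) (a : A) :
  mxscale r (a%:M : 'M[A]_m) = (r *: a)%:M.
Proof. by apply/matrixP=> i j; rewrite !mxE scalerMnr. Qed.

Section BaseCase.
Variables (R : comRingType) (A : algType R) (qA : A -> R) (conj : A -> A).
Hypothesis hA : is_quaternion_algebra qA conj.
Variable S : 'M[A]_(1 + 1) -> Prop.
Hypothesis Ssub : mx_subalg S.
Hypothesis SG : forall a : A, S (block_mx 0 a%:M (conj a)%:M 0).

Lemma subalg_base (x y z : A) (M : 'M[A]_(1 + 1)) :
  S (mxscale (polar qA (x * y - y * x) z) M).
Proof.
have [SD SZ SM] := Ssub.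
pose D (a b : A) : 'M[A]_(1 + 1) := block_mx a%:M 0 0 b%:M.
have DD a b c d : D a b *m D c d = D (a * c) (b * d).
  by rewrite /D mulmx_block !mul0mx !mulmx0 !addr0 !add0r -!scalar_mxM.
have DaD a b c d : D a b + D c d = D (a + c) (b + d).
  by rewrite /D add_block_mx !addr0 -!raddfD.
have DZ r a b : mxscale r (D a b) = D (r *: a) (r *: b).
  by rewrite /D mxscale_block !mxscale0 !mxscale_scalar.
(* This is the product of the generators of [conj u] and 1. *)
have SDc u : S (D (conj u) u).
  have := SM _ _ (SG (conj u)) (SG 1); rewrite (conj1 hA) (conjK hA) /D.
  by rewrite mulmx_block !mul0mx !mulmx0 !addr0 !add0r -!scalar_mxM !mulr1.
have SDB a b c d : S (D a b) -> S (D c d) -> S (D (a - c) (b - d)).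
  by move=> Sab Scd; rewrite -DaD -!(scaleN1r (_ : A)) -DZ; apply: SD => //; apply: SZ.
have SDM a b c d : S (D a b) -> S (D c d) -> S (D (a * c) (b * d)).
  by move=> Sab Scd; rewrite -DD; apply: SM.
(* Since [conj] reverses products, [D (conj u) u * D (conj v) v] and [D (conj (v * u)) (v * u)]
   agree in the first entry, and their difference keeps only a commutator in the second. *)
have Scomm (u v : A) : S (D 0 (u * v - v * u)).
  have := SDB _ _ _ _ (SDM _ _ _ _ (SDc u) (SDc v)) (SDc (v * u)).
  by rewrite (conj_mul hA) subrr.
(* With [c = x * y - y * x], the scalar is [c * conj z + z * conj c], and [conj c] is the commutator
   of [conj y] and [conj x]. *)
have SDt u : S (D 0 (polar qA (x * y - y * x) z *: u)).
  rewrite -mulr_algl (polar_conj hA) -(mul0r (conj u)).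
  apply: (SDM _ _ _ _ _ (SDc u)); rewrite -[0](addr0 (0 : A)) -DaD; apply: SD.
    by have := SDM _ _ _ _ (Scomm x y) (SDc (conj z)); rewrite mul0r.
  have := SDM _ _ _ _ (SDc z) (Scomm (conj y) (conj x)).
  by rewrite mulr0 (conjD hA) (conjN hA) !(conj_mul hA).
set t := polar _ _ _.
rewrite -[M]submxK; set a := ulsubmx M; set b := ursubmx M; set c := dlsubmx M; set d := drsubmx M.
rewrite [a]mx11_scalar [b]mx11_scalar [c]mx11_scalar [d]mx11_scalar.
(* Multiplication by the swap [J] on either side carries the lower right entry to the other three
   places. *)
have := SG 1; rewrite (conj1 hA); set J := block_mx _ _ _ _ => SJ.
pose T u := D 0 (t *: u).
have -> : mxscale t (block_mx (a 0 0)%:M (b 0 0)%:M (c 0 0)%:M (d 0 0)%:M : 'M_(1 + 1)) =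
    J *m T (a 0 0) *m J + J *m T (b 0 0) + T (c 0 0) *m J + T (d 0 0).
  rewrite mxscale_block !mxscale_scalar /J /T /D.
  rewrite !mulmx_block !add_block_mx !mul1mx !mulmx1 !mul0mx !mulmx0.
  by rewrite ?raddf0 ?addr0 ?add0r ?addr0.
have ST u : S (T u) by apply: SDt.
have SJT u : S (J *m T u) by apply: SM.
have STJ u : S (T u *m J) by apply: SM.
have SJTJ u : S (J *m T u *m J) by apply: SM.
by apply: (SD _ _ (SD _ _ (SD _ _ _ _) _) _).
Qed.
End BaseCase.

Lemma mxscaleD (R : comRingType) (A : algType R) (m : nat) (r : R) (X Y : 'M[A]_m) :
  mxscale r (X + Y) = mxscale r X + mxscale r Y.
Proof. by apply/matrixP=> i j; rewrite !mxE scalerDr. Qed.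

Lemma mxscale_mull (R : comRingType) (A : algType R) (m : nat) (r : R) (X Y : 'M[A]_m) :
  mxscale r (X *m Y) = mxscale r X *m Y.
Proof.
apply/matrixP=> i j; rewrite !mxE scaler_sumr; apply: eq_bigr => k _.
by rewrite mxE scalerAl.
Qed.

Lemma mxscale_mulr (R : comRingType) (A : algType R) (m : nat) (r : R) (X Y : 'M[A]_m) :
  mxscale r (X *m Y) = X *m mxscale r Y.
Proof.
apply/matrixP=> i j; rewrite !mxE scaler_sumr; apply: eq_bigr => k _.
by rewrite mxE scalerAr.
Qed.

(** The product of the two antidiagonal matrices given by [p] and [q] is diag(p, q). The conditions
    on [X], [U], [W] say that compressing a generator by it yields the copy of [X x] in the corner,
    so the smaller case applies to the pullback of [S] to that corner. *)
Lemma subalg_corner (R : comRingType) (A : algType R) (t : R) (d : nat) (p q : 'M[A]_d)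
    (I : Type) (X U W : I -> 'M[A]_d) (S : 'M[A]_(d + d) -> Prop) :
  p *m p = p -> p *m q = 0 -> q *m p = 0 -> q *m q = q -> p + q = 1%:M ->
  (forall x, [/\ p *m X x *m p = 0, p *m X x *m q = p *m U x *m q,
                 q *m X x *m p = q *m W x *m p & q *m X x *m q = 0]) ->
  (forall S' : 'M[A]_d -> Prop, mx_subalg S' ->
     (forall x, S' (X x)) -> forall M, S' (mxscale t M)) ->
  mx_subalg S ->
  S (block_mx 0 p q 0) -> S (block_mx 0 q p 0) -> (forall x, S (block_mx 0 (U x) (W x) 0)) ->
  forall M, S (mxscale t M).
Proof.
move=> pp pq qp qq p1 hX IH [SD SZ SM].
set e := block_mx 0 p q 0; set f := block_mx 0 q p 0 => Se Sf SG.
(* [j] is multiplicative and identifies ['M_d] with the corner of [diag(p, q)]; the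
   translates of this corner by [e] and [f] cover all of ['M_(d + d)]. *)
pose j (M : 'M[A]_d) : 'M[A]_(d + d) :=
  block_mx (p *m M *m p) (p *m M *m q) (q *m M *m p) (q *m M *m q).
have sc l r (a b N : 'M[A]_l) : mxscale r (a *m N *m b) = a *m mxscale r N *m b.
  by rewrite mxscale_mull mxscale_mulr.
have ef : e *m f = block_mx p 0 0 q.
  by rewrite /e /f mulmx_block !mul0mx !mulmx0 !addr0 !add0r pp qq.
have Sj N0 : S (j (mxscale t N0)).
  apply: (IH (fun M => S (j M))) => [|x]; last first.
    have := SM _ _ (SM _ _ (SM _ _ Se Sf) (SG x)) (SM _ _ Se Sf).
    rewrite ef /j !mulmx_block !(mul0mx, mulmx0, addr0, add0r).
    by case: (hX x) => -> -> -> ->.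
  (* Multiplicativity of [j] comes from inserting [1 = p + q] between the two factors. *)
  have sandwich (a b M1 M2 : 'M[A]_d) :
      a *m (M1 *m M2) *m b = a *m M1 *m p *m (p *m M2 *m b) + a *m M1 *m q *m (q *m M2 *m b).
    rewrite !mulmxA -(mulmxA _ p p) pp -(mulmxA _ q q) qq -!mulmxDl -mulmxDr p1 mulmx1 //.
  split=> [M N|r M|M N].
  - by move=> SM1 SN; have := SD _ _ SM1 SN; rewrite /j add_block_mx !mulmxDr !mulmxDl.
  - by move=> SM1; have := SZ r _ SM1; rewrite /j mxscale_block !sc.
  - by move=> SM1 SN; have := SM _ _ SM1 SN; rewrite /j mulmx_block -!sandwich.
move=> M0; rewrite -(submxK M0).
move: (ulsubmx M0) (ursubmx M0) (dlsubmx M0) (drsubmx M0) => M1 M2 M3 M4.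
have abcd (a b c g N : 'M[A]_d) : a *m (b *m N *m c) *m g = (a *m b) *m N *m (c *m g).
  by rewrite !mulmxA.
have jt N : mxscale t (j N) = j (mxscale t N).
  by rewrite /j mxscale_block !sc.
(* [c] assembles one Peirce component of each argument, so that [j] of it has these components as
   its four blocks. *)
pose c (M1 M2 M3 M4 : 'M[A]_d) := p *m M1 *m p + p *m M2 *m q + q *m M3 *m p + q *m M4 *m q.
have jc N1 N2 N3 N4 : j (c N1 N2 N3 N4) =
    block_mx (p *m N1 *m p) (p *m N2 *m q) (q *m N3 *m p) (q *m N4 *m q).
  rewrite /j /c !mulmxDr !mulmxDl !abcd !(pp, pq, qp, qq).
  by rewrite !(mul0mx, mulmx0) !(addr0, add0r).
have full (N : 'M[A]_d) :
    N = p *m N *m p + p *m N *m q + (q *m N *m p + q *m N *m q).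
  by rewrite -!mulmxDr p1 !mulmx1 -mulmxDl p1 mul1mx.
have fj N1 N2 N3 N4 : f *m j (c N1 N2 N3 N4) =
    block_mx (q *m N3 *m p) (q *m N4 *m q) (p *m N1 *m p) (p *m N2 *m q).
  by rewrite jc /f mulmx_block !mul0mx !add0r !addr0 !mulmxA pp qq.
have je N1 N2 N3 N4 : j (c N1 N2 N3 N4) *m e =
    block_mx (p *m N2 *m q) (p *m N1 *m p) (q *m N4 *m q) (q *m N3 *m p).
  by rewrite jc /e mulmx_block !mulmx0 !add0r !addr0 -!mulmxA pp qq.
have fje N1 N2 N3 N4 : f *m j (c N1 N2 N3 N4) *m e =
    block_mx (q *m N4 *m q) (q *m N3 *m p) (p *m N2 *m q) (p *m N1 *m p).
  by rewrite fj /e mulmx_block !mulmx0 !add0r !addr0 -!mulmxA pp qq.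
(* The arguments of [c] are permuted so that each block receives all four Peirce components of its
   own [M], one from each summand. *)
have -> : block_mx M1 M2 M3 M4 =
    j (c M1 M2 M3 M4) + f *m j (c M3 M4 M1 M2)
    + (j (c M2 M1 M4 M3) *m e + f *m j (c M4 M3 M2 M1) *m e).
  rewrite jc fj je fje !add_block_mx; congr block_mx; rewrite [LHS]full [LHS]addrACA //.
  - by rewrite addrC.
  - by congr (_ + _); rewrite addrC.
  - by rewrite addrC; congr (_ + _); rewrite addrC.
have Sj' N : S (mxscale t (j N)) by rewrite jt.
rewrite !mxscaleD !sc mxscale_mulr mxscale_mull !jt.
have Sje N : S (j (mxscale t N) *m e) by apply: SM.
have Sfj N : S (f *m j (mxscale t N)) by apply: SM.
by apply: (SD _ _ (SD _ _ _ _) (SD _ _ _ (SM _ _ _ _))).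
Qed.

(** This is [subalg_corner] for the idempotents diag(1, 0) and diag(0, 1), with [G 0 0 1%:M 0] and
    [G 0 0 0 1%:M] coming from a hyperbolic pair. The size [k] is a variable so that eliminating [E]
    removes the casts. *)
Lemma subalg_step (R : comRingType) (A : algType R) (t : R) (m k : nat) (E : (m + m)%N = k)
    (I : Type) (Z Zb a b : I -> 'M[A]_m) (S : 'M[A]_(k + k) -> Prop) :
  (forall S' : 'M[A]_(m + m) -> Prop, mx_subalg S' ->
     (forall x, S' (block_mx 0 (Z x) (Zb x) 0)) -> forall M, S' (mxscale t M)) ->
  mx_subalg S ->
  let G (Z Zb a b : 'M[A]_m) : 'M[A]_(k + k) :=
    block_mx 0 (castmx (E, E) (block_mx a Z (- Zb) b))
             (castmx (E, E) (block_mx b (- Z) Zb a)) 0 in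
  S (G 0 0 1%:M 0) -> S (G 0 0 0 1%:M) -> (forall x, S (G (Z x) (Zb x) (a x) (b x))) ->
  forall M, S (mxscale t M).
Proof.
case: k / E S => S IH Ssub G; rewrite /G !castmx_id {G} !oppr0 => Se Sf SG.
apply: (subalg_corner (X := fun x => block_mx 0 (Z x) (Zb x) 0)
  (U := fun x => block_mx (a x) (Z x) (- Zb x) (b x))
  (W := fun x => block_mx (b x) (- Z x) (Zb x) (a x)) _ _ _ _ _ _ IH Ssub Se Sf); first [
  by rewrite mulmx_block !(mul0mx, mulmx0, mul1mx, addr0, add0r) ?block_mx0
| by rewrite add_block_mx !addr0 add0r -scalar_mx_block
| idtac].
- by move=> x; rewrite !mulmx_block !(mul0mx, mulmx0, mul1mx, mulmx1, addr0, add0r) !block_mx0.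
- by move=> x; apply: SG.
Qed.

Lemma rv_at0 (R : comRingType) (n i : nat) : rv_at (0 : 'rV[R]_n) i = 0.
Proof. by rewrite /rv_at; case: insub => // j; rewrite mxE. Qed.

Lemma rv_at_delta (R : comRingType) (n : nat) (i : 'I_n) (j : nat) :
  rv_at (delta_mx 0 i : 'rV[R]_n) j = (j == i)%:R.
Proof.
rewrite /rv_at; case: insubP => [k _ <-|]; first by rewrite mxE.
by rewrite -leqNgt => nj; rewrite gtn_eqF // (leq_trans _ nj).
Qed.

Lemma Zpair0 (R : comRingType) (A : algType R) (conj : A -> A) (n : nat)
    (v w : 'rV[R]_n) (i : nat) :
  conj 0 = 0 -> (forall j, (j < i)%N -> rv_at v j = 0) ->
  (forall j, (j < i)%N -> rv_at w j = 0) -> Zpair conj 0 v w i = (0, 0).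
Proof.
move=> c0; elim: i => [|i IH] v0 w0 /=; first by rewrite c0 raddf0.
rewrite IH; [|by move=> j ji; apply: v0; rewrite ltnW..|by move=> j ji; apply: w0; rewrite ltnW].
by rewrite /= v0 // w0 // oppr0 scale0r raddf0 block_mx0 castmx_const.
Qed.

Lemma subalg_gamma (R : comRingType) (A : algType R) (qA : A -> R) (conj : A -> A)
    (n k : nat) (E : (2 ^ n + 2 ^ n)%N = k) (S : 'M[A]_k -> Prop) (x y z : A) :
  is_quaternion_algebra qA conj -> mx_subalg S ->
  (forall (al : A) (v w : 'rV[R]_n), S (castmx (E, E)
     (block_mx 0 (Zpair conj al v w n).1 (Zpair conj al v w n).2 0))) ->
  forall M, S (mxscale (polar qA (x * y - y * x) z) M).
Proof.
move=> hA; case: k / E S => S Ssub SG.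
have {}SG (p : A * ('rV[R]_n * 'rV[R]_n)) : S (block_mx 0 (Zpair conj p.1 p.2.1 p.2.2 n).1
   (Zpair conj p.1 p.2.1 p.2.2 n).2 0) by have := SG p.1 p.2.1 p.2.2; rewrite castmx_id.
set t := polar _ _ _.
(* The induction is on the level [i] of [Zpair], with [v] and [w] kept in [R^n], since level [i]
   reads only the coordinates below [i]. *)
suff H i : (i <= n)%N -> forall S : 'M[A]_(2 ^ i + 2 ^ i) -> Prop, mx_subalg S ->
  (forall p : A * ('rV[R]_n * 'rV[R]_n), S (block_mx 0 (Zpair conj p.1 p.2.1 p.2.2 i).1
   (Zpair conj p.1 p.2.1 p.2.2 i).2 0)) -> forall M, S (mxscale t M).
  by move=> M; apply: (H n).
clear S Ssub SG; elim: i => [|i IH] lein S Ssub SG.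
  by apply: (subalg_base hA Ssub) => al; have := SG (al, (0, 0)).
have Z00 (v w : 'rV[R]_n) : (forall j, (j < i)%N -> rv_at v j = 0) ->
  (forall j, (j < i)%N -> rv_at w j = 0) -> Zpair conj 0 v w i = (0, 0).
  by move=> v0 w0; exact (Zpair0 (conj0 hA) v0 w0).
have d0 j : (j < i)%N -> rv_at (delta_mx 0 (Ordinal lein) : 'rV[R]_n) j = 0.
  by move=> ji; rewrite rv_at_delta /= (ltn_eqF ji).
have z0 j : (j < i)%N -> rv_at (0 : 'rV[R]_n) j = 0 by rewrite rv_at0.
apply: (@subalg_step R A t _ _ (pow2S i) (A * ('rV[R]_n * 'rV[R]_n))
  (fun p => (Zpair conj p.1 p.2.1 p.2.2 i).1) (fun p => (Zpair conj p.1 p.2.1 p.2.2 i).2)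
  (fun p => ((rv_at p.2.1 i)%:A)%:M) (fun p => ((rv_at p.2.2 i)%:A)%:M)
  S (IH (ltnW lein)) Ssub) => [||p].
(* The hyperbolic pair at coordinate [i] has no lower coordinates, so the blocks of level [i] vanish
   and only the new scalars 1 and 0 remain. *)
- have := SG (0, (delta_mx 0 (Ordinal lein), 0)).
  by rewrite /= Z00 //= rv_at_delta rv_at0 eqxx scale0r scale1r !raddf0.
- have := SG (0, (0, delta_mx 0 (Ordinal lein))).
  by rewrite /= Z00 //= rv_at_delta rv_at0 eqxx scale0r scale1r !raddf0.
- exact: SG p.
Qed.

(** * Spanning the Clifford algebra *)

Section GeneratedSubalgebra.
Variables (R : comRingType) (C : algType R) (V : Type) (iota : V -> C).

Inductive generated : C -> Prop :=
| generated_gen v : generated (iota v)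
| generated_one : generated 1
| generated_lin r x y : generated x -> generated y -> generated (r *: x + y)
| generated_mul x y : generated x -> generated y -> generated (x * y).

(** The classical boolean form lets the generated subalgebra become an [algType], to which the
    universal property can be applied. *)
Definition generated_pred : {pred C} := fun x => boolp.asbool (generated x).

Lemma generated_predP x : reflect (generated x) (x \in generated_pred).
Proof. exact: boolp.asboolP. Qed.

Fact generated_subalg_closed : subalg_closed generated_pred.
Proof.
split; first by apply/generated_predP; exact: generated_one.
- move=> r x y /generated_predP ? /generated_predP ?; apply/generated_predP.
  exact: generated_lin.
- move=> x y /generated_predP ? /generated_predP ?; apply/generated_predP.
  exact: generated_mul.
Qed.

HB.instance Definition _ := GRing.isSubalgClosed.Build R C generated_pred generated_subalg_closed.

Record generated_alg := GeneratedAlg {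
  generated_val :> C;
  generated_valP : generated_val \in generated_pred }.

HB.instance Definition _ := [isSub for generated_val].
HB.instance Definition _ := [Choice of generated_alg by <:].
HB.instance Definition _ := [SubChoice_isSubAlgebra of generated_alg by <:].

End GeneratedSubalgebra.

(** [iota] factors through the generated subalgebra, and the resulting homomorphism followed by the
    inclusion extends [iota], as the identity does; by uniqueness the two agree. *)
Lemma clifford_generated (R : comRingType) (V : lmodType R) (q : V -> R)
    (C : algType R) (iota : V -> C) :
  is_clifford_algebra q iota -> forall x, generated iota x.
Proof.
move=> [[lin sq] univ].
have inP v : iota v \in generated_pred iota by apply/generated_predP; exact: generated_gen.
pose f v : generated_alg iota := GeneratedAlg (inP v).
have cf : clifford_map q f.
  split=> [r x y|x]; apply: val_inj; rewrite /= ?lin ?sq //.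
have [g [[[glin [gmul g1]] gf] _]] := univ _ _ cf.
have [h [_ hU]] := univ C iota (conj lin sq).
have gx : (fun x => val (g x)) = id.
  have <- := hU id (conj (conj (fun _ _ _ => erefl) (conj (fun _ _ => erefl) erefl))
                     (fun=> erefl)).
  apply/esym/hU; split; last by move=> v; rewrite gf.
  by split; [|split] => [r x y|x y|]; rewrite ?glin ?gmul ?g1.
by move=> x; rewrite -[x]/(id x) -gx; apply/generated_predP/valP.
Qed.

Section Words.
Variables (R : comRingType) (C : algType R).

(** The span of the products of subsequences of [xs] in order: [u] collects those avoiding the first
    letter, [x * v] those starting with it. *)
Fixpoint wspan (xs : seq C) : C -> Prop :=
  if xs is x :: s then fun y => exists u v, [/\ wspan s u, wspan s v & y = u + x * v]
  else fun y => exists r : R, y = r%:A.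

Fixpoint words (xs : seq C) : seq C :=
  if xs is x :: s then words s ++ map ( *%R x) (words s) else [:: 1].

Lemma size_words xs : size (words xs) = (2 ^ size xs)%N.
Proof. by elim: xs => //= x s IH; rewrite size_cat size_map IH expnS mul2n addnn. Qed.

Lemma wspan_lin xs r x y : wspan xs x -> wspan xs y -> wspan xs (r *: x + y).
Proof.
elim: xs r x y => [|a s IH] r x y /=.
  by move=> [c ->] [d ->]; exists (r * c + d); rewrite scalerDl scalerA.
move=> [u [v [Wu Wv ->]]] [u' [v' [Wu' Wv' ->]]].
exists (r *: u + u'), (r *: v + v'); split; try exact: IH.
by rewrite mulrDr scalerDr -scalerAr addrACA.
Qed.

Lemma wspan0 xs : wspan xs 0.
Proof.
elim: xs => [|a s IH] /=; first by exists 0; rewrite scale0r.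
by exists 0, 0; split=> //; rewrite mulr0 addr0.
Qed.

Lemma wspan1 xs : wspan xs 1.
Proof.
elim: xs => [|a s IH] /=; first by exists 1; rewrite scale1r.
by exists 1, 0; split=> //; [apply: wspan0|rewrite mulr0 addr0].
Qed.

(** A letter equal to the head [x] is absorbed since [x * x] is scalar; a later letter [a] is moved
    past [x] by [a * x = r - x * a] and then multiplied into the span of the tail. *)
Lemma wspan_mul xs :
  (forall a b, a \in xs -> b \in xs -> exists r : R, a * b + b * a = r%:A) ->
  (forall a, a \in xs -> exists r : R, a * a = r%:A) ->
  forall a y, a \in xs -> wspan xs y -> wspan xs (a * y).
Proof.
elim: xs => [|x s IH] //= anti sq a y.
have ins b : b \in s -> b \in x :: s by rewrite inE orbC => ->.
have {}IH := IH (fun a b ha hb => anti a b (ins a ha) (ins b hb)) (fun a ha => sq a (ins a ha)).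
move=> ha [u [v [Wu Wv ->]]].
have Wr r : wspan s (r *: v) by rewrite -[_ *: _]addr0; apply: wspan_lin (wspan0 _).
move: ha; rewrite inE => /predU1P [->|sa].
  have [r xx] := sq x (mem_head _ _).
  by exists (r *: v), u; split=> //; rewrite mulrDr mulrA xx mulr_algl addrC.
have [r ax] := anti a x (ins a sa) (mem_head _ _).
exists (r *: v + a * u), (-1 *: (a * v) + 0); split.
- by apply: wspan_lin => //; apply: IH.
- by apply: wspan_lin; [apply: IH|apply: wspan0].
rewrite addr0 scaleN1r mulrN mulrDr !mulrA -mulr_algl -ax mulrDl.
by rewrite addrAC addrK addrC.
Qed.

Lemma wspanP xs y : wspan xs y ->
  exists c : nat -> R, y = \sum_(0 <= i < size (words xs)) c i *: (words xs)`_i.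
Proof.
elim: xs y => [|x s IH] y /=; first by move=> [r ->]; exists (fun=> r); rewrite big_nat1.
move=> [u [v [/IH [c ->] /IH [d ->] ->]]].
set n := size (words s).
exists (fun i => if (i < n)%N then c i else d (i - n)%N).
rewrite size_cat size_map -/n [RHS](@big_cat_nat _ _ _ n) ?leq_addr //=; congr (_ + _).
  by apply: eq_big_nat => i /andP[_ lin]; rewrite lin nth_cat -/n lin.
rewrite -{2}[n]add0n big_addn addnK mulr_sumr; apply: eq_big_nat => i /andP[_ lin].
by rewrite ltnNge leq_addl addnK nth_cat -/n ltnNge leq_addl addnK (nth_map 0) // -scalerAr.
Qed.

End Words.

(** * Injectivity from an image with faithful denominators *)

Section MatrixModule.
Variables (R : comRingType) (A : algType R) (m : nat).

(* The canonical module structure of ['M[A]_m] is over [A]; this alias carries the one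
   over [R] given by [mxscale]. *)
Definition mx_module := 'M[A]_m.

HB.instance Definition _ := GRing.Zmodule.on mx_module.

Fact mxscaleA r s (X : mx_module) : mxscale r (mxscale s X) = mxscale (r * s) X.
Proof. by apply/matrixP=> i j; rewrite !mxE scalerA. Qed.

Fact mxscale1 : left_id 1 (@mxscale R A m : R -> mx_module -> mx_module).
Proof. by move=> X; apply/matrixP=> i j; rewrite !mxE scale1r. Qed.

Fact mxscaleDr : right_distributive (@mxscale R A m : R -> mx_module -> mx_module) +%R.
Proof. by move=> r X Y; apply: mxscaleD. Qed.

Fact mxscaleDl (X : mx_module) : {morph (@mxscale R A m)^~ X : r s / r + s}.
Proof. by move=> r s; apply/matrixP=> i j; rewrite !mxE scalerDl. Qed.

HB.instance Definition _ :=
  GRing.Zmodule_isLmodule.Build R mx_module mxscaleA mxscale1 mxscaleDr mxscaleDl.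

End MatrixModule.

Lemma mx_basis (R : comRingType) (A : algType R) (m d : nat) (b : 'I_d -> A) :
  is_basis (@GRing.scale R A) b ->
  exists e : 'I_(m * m * d) -> 'M[A]_m, is_basis (@mxscale R A m) e.
Proof.
move=> bB; pose T := ('I_m * 'I_m * 'I_d)%type.
have <- : #|{: T}| = (m * m * d)%N by rewrite !card_prod !card_ord.
pose E (x : T) : 'M[A]_m := \matrix_(u, v) if x.1 == (u, v) then b x.2 else 0.
have entry (c : T -> R) u v :
    (\sum_(i < #|{: T}|) mxscale (c (enum_val i)) (E (enum_val i))) u v =
    \sum_l c (u, v, l) *: b l.
  rewrite -(big_enum_val (A := {: T}) (fun x => mxscale (c x) (E x))) summxE.
  transitivity (\sum_x mxscale (c x) (E x) u v); first exact: eq_bigl.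
  rewrite (eq_bigr (fun x => mxscale (c (x.1, x.2)) (E (x.1, x.2)) u v)); last by case.
  rewrite -(pair_bigA _ (fun w l => mxscale (c (w, l)) (E (w, l)) u v)) /=.
  rewrite (bigD1 (u, v)) //= [X in _ + X]big1 ?addr0 => [|w /negbTE wuv].
    by apply: eq_bigr => l _; rewrite !mxE eqxx.
  by apply: big1 => l _; rewrite !mxE /= wuv scaler0.
exists (fun i => E (enum_val i)) => M.
have [c Mc] : exists c : T -> R, forall u v, M u v = \sum_l c (u, v, l) *: b l.
  have /fin_all_exists [c Mc] : forall w : 'I_m * 'I_m, exists c : 'rV[R]_d,
      M w.1 w.2 = \sum_l c 0 l *: b l.
    by move=> w; have [c [Mc _]] := bB (M w.1 w.2); exists c.
  by exists (fun x => c x.1 0 x.2) => u v; rewrite (Mc (u, v)).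
exists (\row_i c (enum_val i)); split.
  apply/matrixP=> u v; rewrite Mc -entry !summxE.
  by apply: eq_bigr => i _; rewrite !mxE.
move=> c' Mc'; apply/rowP=> i; rewrite mxE.
case Ei: (enum_val i) => [[u v] l].
have := entry (fun x => c' 0 (enum_rank x)) u v.
rewrite -[X in fun_of_matrix X _ _](_ : M = _); last first.
  by rewrite Mc'; apply: eq_bigr => k _; rewrite enum_valK.
by rewrite Mc => /(basis_inj bB)/(_ l) ->; rewrite -Ei enum_valK.
Qed.

Lemma is_Rlinear_sum (R : comRingType) (U W : lmodType R) (f : U -> W)
    (k : nat) (c : 'I_k -> R) (e : 'I_k -> U) :
  is_Rlinear f -> f (\sum_i c i *: e i) = \sum_i c i *: f (e i).
Proof.
move=> flin.
have f0 : f 0 = 0 by apply: (addrI (f 0)); have := flin 1 0 0; rewrite !scale1r !addr0 => <-.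
elim/big_rec2: _ => // i x y _ <-; exact: flin.
Qed.

(** Let [PM] be the square matrix of the [phi (e i)] in the basis [b]. As [t i] times [b] lies in
    the image, [QM *m PM] is the scalar matrix [t i], so [\det PM] divides [t i ^+ k]. A relation is
    annihilated by [\det PM] through the adjugate, hence by all [t i ^+ k], hence is zero. *)
Lemma injective_faithful_image (R : comRingType) (C D : lmodType R) (phi : C -> D)
    (k : nat) (e : 'I_k -> C) (b : 'I_k -> D) (I : finType) (t : I -> R) :
  is_Rlinear phi -> is_basis (@GRing.scale R D) b ->
  (forall x, exists c : 'I_k -> R, x = \sum_i c i *: e i) ->
  (forall r, (forall i, t i * r = 0) -> r = 0) ->
  (forall i y, exists x, phi x = t i *: y) ->
  injective phi /\ is_basis (@GRing.scale R C) e.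
Proof.
move=> philin bB espan faith tim.
have indep (c : 'I_k -> R) : \sum_i c i *: phi (e i) = 0 -> forall i, c i = 0.
  move=> c0 l.
  have /fin_all_exists [P Pe] : forall i, exists p : 'rV[R]_k, phi (e i) = \sum_j p 0 j *: b j.
    by move=> i; have [p [pe _]] := bB (phi (e i)); exists p.
  pose PM : 'M[R]_k := \matrix_i P i.
  have cP : (\row_i c i) *m PM = 0.
    apply/rowP=> j; rewrite [RHS]mxE.
    apply: (basis_inj bB (c := fun j => ((\row_i c i) *m PM) 0 j) (d := fun=> 0)).
    rewrite [RHS]big1 => [|? _]; last by rewrite scale0r.
    rewrite -[RHS]c0; under [RHS]eq_bigr => i _ do rewrite Pe scaler_sumr.
    rewrite exchange_big /=; apply: eq_bigr => j' _; rewrite mxE scaler_suml.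
    by apply: eq_bigr => i _; rewrite !mxE scalerA.
  have detc : \det PM * c l = 0.
    have := congr1 (fun v => v *m \adj PM) cP; rewrite /= mul0mx -mulmxA mul_mx_adj.
    by rewrite mul_mx_scalar => /rowP/(_ l); rewrite !mxE.
  apply: (@faithful_powers _ (fun=> True) _ t _ _ k) => // [r _|i]; first exact: faith.
  have /fin_all_exists [Q Qb] : forall j, exists q : {ffun 'I_k -> R},
      t i *: b j = \sum_l q l *: phi (e l).
    move=> j; have [x <-] := tim i (b j); have [q ->] := espan x.
    exists (finfun q); rewrite is_Rlinear_sum //.
    by apply: eq_bigr => l' _; rewrite ffunE.
  pose QM : 'M[R]_k := \matrix_(j, l) Q j l.
  have QP : QM *m PM = (t i)%:M.
    apply/matrixP=> j j'.
    apply: (basis_inj bB (c := fun j' => (QM *m PM) j j') (d := fun j' => (t i)%:M j j')).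
    rewrite [RHS](bigD1 j) //= mxE eqxx mulr1n [X in _ = _ + X]big1 ?addr0 => [|u /negbTE uj].
      rewrite Qb; under [RHS]eq_bigr => u _ do rewrite Pe scaler_sumr.
      rewrite exchange_big /=; apply: eq_bigr => v _; rewrite mxE scaler_suml.
      by apply: eq_bigr => u _; rewrite !mxE scalerA.
    by rewrite mxE eq_sym uj mulr0n scale0r.
  by rewrite -det_scalar -QP det_mulmx -mulrA detc mulr0.
have subr_phi x y : phi (x - y) = phi x - phi y.
  by rewrite addrC -scaleN1r philin scaleN1r addrC.
have inj : injective phi.
  move=> x y xy; apply/eqP; rewrite -subr_eq0; have [c xyc] := espan (x - y).
  rewrite xyc big1 // => i _; rewrite indep ?scale0r //.
  by rewrite -is_Rlinear_sum // -xyc subr_phi xy subrr.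
split=> // x; have [c xc] := espan x; exists (\row_i c i); split.
  by rewrite xc; apply: eq_bigr => i _; rewrite mxE.
move=> d xd; apply/rowP=> i; rewrite mxE; apply/eqP; rewrite -subr_eq0; apply/eqP.
apply: (indep (fun i => c i - d 0 i)).
rewrite -is_Rlinear_sum //; under eq_bigr => j _ do rewrite scalerBl.
by rewrite sumrB -xc -xd subr_phi subrr.
Qed.

(** * The spanning products of Cl(V) and the rank count *)

(** Squares and anticommutators of vectors are scalars in Cl(V), so the span of the ordered products
    is stable under left multiplication by each [iota v], hence by everything generated; it also
    contains 1. That [vs] spans [V] is phrased as an induction principle. *)
Lemma clifford_span (R : comRingType) (V : lmodType R) (q : V -> R)
    (C : algType R) (iota : V -> C) (vs : seq V) :
  is_clifford_algebra q iota ->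
  (forall P : V -> Prop, P 0 -> (forall r x y, P x -> P y -> P (r *: x + y)) ->
     (forall v, v \in vs -> P v) -> forall v, P v) ->
  forall x, exists c : 'I_(2 ^ size vs) -> R,
    x = \sum_i c i *: (words (map iota vs))`_i.
Proof.
move=> hC spanV x; have [[lin sq] _] := hC.
set xs := map iota vs.
have iota0 : iota 0 = 0.
  by apply: (addrI (iota 0)); have := lin 1 0 0; rewrite !scale1r !addr0 => <-.
have iotaD u v : iota (u + v) = iota u + iota v by have := lin 1 u v; rewrite !scale1r.
have W v y : wspan xs y -> wspan xs (iota v * y).
  move=> Wy; move: v; apply: spanV => [|r u v Wu Wv|v vvs].
  - by rewrite iota0 mul0r; apply: wspan0.
  - by rewrite lin mulrDl -scalerAl; apply: wspan_lin.
  apply: wspan_mul Wy; last exact: map_f.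
  - move=> _ _ /mapP[u _ ->] /mapP[w _ ->]; exists (q (u + w) - q u - q w).
    rewrite !scalerBl -!sq iotaD mulrDl !mulrDr.
    by apply/esym/eqP; rewrite !subr_eq [eqbRHS]addrC !addrA.
  - by move=> _ /mapP[u _ ->]; exists (q u).
have Wgen : wspan xs x.
  rewrite -[x]mulr1; move: (1 : C) (wspan1 xs) => y.
  elim: (clifford_generated hC x) y => [v|//|r u v _ IHu _ IHv|u v _ IHu _ IHv] y Wy.
  - exact: W.
  - by rewrite mul1r.
  - by rewrite mulrDl -scalerAl; apply: wspan_lin; [apply: IHu|apply: IHv].
  - by rewrite -mulrA; apply/IHu/IHv.
have [c ->] := wspanP Wgen; exists (fun i => c i).
by rewrite size_words size_map big_mkord.
Qed.

Definition hyperbolic_gens (R : comRingType) (A : algType R) (b : 'I_4 -> A) (n : nat) :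
    seq (A * ('rV[R]_n * 'rV[R]_n)) :=
  [seq (b i, (0, 0)) | i <- enum 'I_4] ++
  [seq (0, (delta_mx 0 i, 0)) | i <- enum 'I_n] ++
  [seq (0, (0, delta_mx 0 i)) | i <- enum 'I_n].

Lemma size_hyperbolic_gens (R : comRingType) (A : algType R) (b : 'I_4 -> A) (n : nat) :
  size (hyperbolic_gens b n) = (4 + (n + n))%N.
Proof. by rewrite !size_cat; congr (_ + (_ + _))%N; rewrite size_map size_enum_ord. Qed.

Lemma hyperbolic_gens_span (R : comRingType) (A : algType R) (b : 'I_4 -> A) (n : nat) :
  is_basis (@GRing.scale R A) b ->
  forall P : A * ('rV[R]_n * 'rV[R]_n) -> Prop,
  P 0 -> (forall r x y, P x -> P y -> P (r *: x + y)) ->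
  (forall v, v \in hyperbolic_gens b n -> P v) -> forall v, P v.
Proof.
move=> bB P P0 Plin Pgens [al [v w]].
have Psum m (c : 'I_m -> R) (u : 'I_m -> A * ('rV[R]_n * 'rV[R]_n)) :
    (forall i, P (u i)) -> P (\sum_i c i *: u i).
  move=> Pu; elim/big_ind: _ => [//|x y Px Py|i _].
    by rewrite -[x]scale1r; apply: Plin.
  by rewrite -[_ *: _]addr0; apply: Plin.
have PD x y : P x -> P y -> P (x + y) by move=> Px Py; rewrite -[x]scale1r; apply: Plin.
have [c [al_c _]] := bB al.
have -> : (al, (v, w)) = \sum_i c 0 i *: (b i, (0, 0)) +
    (\sum_i v 0 i *: (0, (delta_mx 0 i, 0)) + \sum_i w 0 i *: (0, (0, delta_mx 0 i))).
  have pairS (U1 U2 : lmodType R) m (f : 'I_m -> U1 * U2) :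
      \sum_i f i = (\sum_i (f i).1, \sum_i (f i).2).
    by elim/big_rec3: _ => // i x y z _ ->; case: (f i).
  have Z0 (U : lmodType R) m (f : 'I_m -> R) : \sum_i f i *: (0 : U) = 0.
    by apply: big1 => i _; rewrite scaler0.
  rewrite !pairS /= -al_c -!row_sum_delta !Z0.
  transitivity (al + (0 + 0), (0 + (v + 0), (0 : 'rV[R]_n) + (0 + w))) => //.
  by rewrite !addr0 !add0r.
have in_gens v0 : v0 \in hyperbolic_gens b n =
   [|| v0 \in [seq (b i, (0, 0)) | i <- enum 'I_4],
       v0 \in [seq (0, (delta_mx 0 i, 0)) | i <- enum 'I_n]
     | v0 \in [seq (0, (0, delta_mx 0 i)) | i <- enum 'I_n]] by rewrite !mem_cat.
apply: (PD _ _ _ (PD _ _ _ _)); apply: Psum => i; apply: Pgens; rewrite in_gens;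
  apply/or3P; [apply: Or31|apply: Or32|apply: Or33];
  by apply: map_f; rewrite mem_enum.
Qed.

Theorem theorem9p1 (R : comRingType) (A : algType R) (qA : A -> R) (conj : A -> A)
    (hA : is_quaternion_algebra qA conj)
    (n : nat) (hn : (1 <= n)%N)
    (C : algType R) (iota : A * ('rV[R]_n * 'rV[R]_n) -> C)
    (hC : is_clifford_algebra (qV qA (n:=n)) iota)
    (phi : C -> 'M[A]_(2 ^ n.+1))
    (phi_add : forall x y : C, phi (x + y) = phi x + phi y)
    (phi_scale : forall (r : R) (x : C), phi (r *: x) = mxscale r (phi x))
    (phi_mul : forall x y : C, phi (x * y) = phi x *m phi y)
    (phi_one : phi 1 = 1%:M)
    (phi_ext : forall x : A * ('rV[R]_n * 'rV[R]_n), phi (iota x) = gammaV conj x) :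
  injective phi /\
  exists k : nat,
    (exists b : 'I_k -> C, is_basis (@GRing.scale R C) b) /\
    (exists b : 'I_k -> 'M[A]_(2 ^ n.+1), is_basis (@mxscale R A _) b).
Proof.
have [_ [[b bB] _]] := hA.
have [f fB] : exists f : 'I_(2 ^ size (hyperbolic_gens b n)) -> 'M[A]_(2 ^ n.+1),
    is_basis (@mxscale R A _) f.
  (* The ranks agree here: both sides are [2 ^ (4 + 2n)], so the basis of matrices and the spanning
     products share one index type. *)
  have -> : (2 ^ size (hyperbolic_gens b n) = 2 ^ n.+1 * 2 ^ n.+1 * 4)%N.
    rewrite size_hyperbolic_gens expnD (expnD _ n n) (expnS _ n) -[(2 ^ 4)%N]/16%N; lia.
  exact: mx_basis bB.
pose e (i : 'I_(2 ^ size (hyperbolic_gens b n))) : C :=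
  (words (map iota (hyperbolic_gens b n)))`_i.
pose t (i : 'I_4 * 'I_4 * 'I_4) :=
  polar qA (b i.1.1 * b i.1.2 - b i.1.2 * b i.1.1) (b i.2).
have [] := @injective_faithful_image R C (mx_module A (2 ^ n.+1)) phi _ e f _ t _ fB.
- by move=> r x y; rewrite phi_add phi_scale.
- exact: clifford_span hC (hyperbolic_gens_span bB).
- move=> r r0; apply: (polar_commutator_faithful hA bB) => i j l.
  exact: (r0 (i, j, l)).
- move=> i y.
  (* The image of [phi] is a subalgebra containing all the vectors, so it contains [t i] times every
     matrix. *)
  pose S (X : 'M[A]_(2 ^ n.+1)) := exists x, phi x = X.
  apply: (@subalg_gamma R A qA conj n _ (pow2S n) S _ _ _ hA).
    split=> [_ _ [u <-] [v <-]|r _ [u <-]|_ _ [u <-] [v <-]].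
    - by exists (u + v).
    - by exists (r *: u).
    - by exists (u * v).
  by move=> al v w; exists (iota (al, (v, w))); rewrite phi_ext.
move=> phi_inj eB; split=> //.
by exists (2 ^ size (hyperbolic_gens b n))%N; split; [exists e|exists f].
Qed.
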